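(* Let $p>3$ be a prime and, for $n\in\mathbb{N}$, let $f_n=\sum_{k=0}^n\binom{n}{k}^3$ be the Franel numbers. Then $$\sum_{k=0}^{p-1}(-1)^k f_k\equiv \left(\frac{p}{3}\right)+\frac{2p^2}{3}B_{p-2}\left(\frac13\right)\pmod{p^3}.$$
   Context: $\left(\frac{\cdot}{3}\right)$ denotes the Legendre symbol. $B_n(x)=\sum_{k=0}^n\binom nk B_k x^{n-k}$ is the $n$th Bernoulli polynomial, where $B_k$ are the Bernoulli numbers. Congruences between rational numbers are understood in the ring of rationals whose denominators are coprime to $p$: $a\equiv b\pmod{p^m}$ means $(a-b)/p^m$ is such a rational. *)

(* Defs.v *)
From mathcomp Require Import all_boot all_order all_algebra.
Set Implicit Arguments. Unset Strict Implicit. Unset Printing Implicit Defensive.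
Import Order.TTheory GRing.Theory Num.Theory.
Local Open Scope ring_scope.

(* Bernoulli numbers B_0, ..., B_n, via the recurrence
   sum_{k=0}^{m} C(m+1,k) B_k = 0 for m >= 1, B_0 = 1  (so B_1 = -1/2). *)
Fixpoint bern_seq (n : nat) : seq rat :=
  match n with
  | 0 => [:: 1]
  | m.+1 => let s := bern_seq m in
      rcons s (- (m.+2%:R)^-1 * \sum_(k < m.+1) ('C(m.+2, k))%:R * s`_k)
  end.

Definition bernoulli (n : nat) : rat := (bern_seq n)`_n.

Definition bernoulli_poly (n : nat) (x : rat) : rat :=
  \sum_(k < n.+1) ('C(n, k))%:R * bernoulli k * x ^+ (n - k).

Definition franel (n : nat) : nat := \sum_(k < n.+1) 'C(n, k) ^ 3.

(* Legendre symbol (p/3): the residues mod 3 are {1}, nonresidues {2}. *)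
Definition legendre3 (p : nat) : rat :=
  if (p %% 3 == 1)%N then 1 else if (p %% 3 == 2)%N then -1 else 0.

(* a = b (mod p^m) in the ring of rationals with denominator coprime to p *)
Definition rat_congr (p m : nat) (a b : rat) : Prop :=
  coprime p `|denq ((a - b) / (p ^ m)%:R)|%N.

(* Main.v *)
Require Import Defs.
From mathcomp Require Import all_boot all_order all_algebra.
From mathcomp Require Import finfield zify ring.
Set Implicit Arguments. Unset Strict Implicit. Unset Printing Implicit Defensive.
Import Order.TTheory GRing.Theory Num.Theory.
Local Open Scope ring_scope.

(** Let phi f be the coefficient of X^(p-1) in f / (1 + X + X^2), so that phi is
    a sum of coefficients of f against the character chi modulo 3, and put
    s = 1 + X and G = (s^p - 1 - X^p) / p.  The Franel number f_n is the
    coefficient of x^n y^n in w^n, where w = (x+y)(1+x)(1+y), and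
    w + xy = (x + y + xy)(1 + x + y).  Hence sum_(n<p) (-1)^n f_n is a diagonal
    coefficient of (w^p + (xy)^p) / ((x + y + xy)(1 + x + y)), and partial
    fractions in y turn it into
      sum_(k+l<p) (-1)^(k+l) C(p,k) C(p,l) phi (X^l s^(2p-k-l) - X^(p-k) s^(k+l)).
    The terms with k = 0 or l = 0 can be summed by the binomial theorem and give
    chi(p) - p^2 phi(G^2); the others give p^2 tau with tau = - phi(G^2) mod p.
    Since s^p - 1 - X^p is divisible by 1 + X + X^2, the number phi(G^2) mod p
    reduces to a sum of inverse squares, namely - 2/3 chi(p) Q, where
    Q = sum_(j<p/3) 1/j^2.  Finally B_(p-2)(1/3) = 2 chi(p) Q mod p, by
    evaluating B_(p-2) at an integer congruent to 1/3 and using B_(p-2) = 0. *)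

(** * The character modulo 3 and the functional phi *)

Definition chi (R : pzRingType) (n : nat) : R :=
  if (n %% 3 == 1)%N then 1 else if (n %% 3 == 2)%N then -1 else 0.

Lemma chi_mod (R : pzRingType) (m n : nat) :
  m = n %[mod 3] -> chi R m = chi R n.
Proof. by rewrite /chi => ->. Qed.

Lemma chi_sum3 (R : pzRingType) (n : nat) :
  chi R n + chi R n.+1 + chi R n.+2 = 0.
Proof.
by rewrite /chi; repeat (case: eqP => ?); try (exfalso; lia);
  rewrite ?(addr0, add0r, addrN, addNr).
Qed.

Lemma rmorph_chi (R S : pzRingType) (f : {rmorphism R -> S}) (n : nat) :
  f (chi R n) = chi S n.
Proof. by rewrite /chi (fun_if f) (fun_if f) rmorphN rmorph1 rmorph0. Qed.

Section Phi.
Variable R : comNzRingType.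
Implicit Types (f g : {poly R}) (N : nat).

(* The truncation of 1 / (1 + X + X^2) at order N. *)
Definition chi_poly N : {poly R} := \poly_(i < N) chi R i.+1.

Definition phi N f : R := (f * chi_poly N)`_N.-1.

Lemma phiE N f : (0 < N)%N -> phi N f = \sum_(j < N) f`_j * chi R (N - j).
Proof.
case: N => // N _; rewrite /phi coefM /=; apply: eq_bigr => j _.
by rewrite coef_poly ltnS leq_subr subSn // -ltnS.
Qed.

Lemma phiD N f g : phi N (f + g) = phi N f + phi N g.
Proof. by rewrite /phi mulrDl coefD. Qed.

Lemma phiN N f : phi N (- f) = - phi N f.
Proof. by rewrite /phi mulNr coefN. Qed.

Lemma phiB N f g : phi N (f - g) = phi N f - phi N g.
Proof. by rewrite phiD phiN. Qed.

Lemma phiMC N c f : phi N (c%:P * f) = c * phi N f.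
Proof. by rewrite /phi -mulrA coefCM. Qed.

Lemma phi_sum N (I : Type) (r : seq I) (P : pred I) (F : I -> {poly R}) :
  phi N (\sum_(i <- r | P i) F i) = \sum_(i <- r | P i) phi N (F i).
Proof. by rewrite /phi mulr_suml coef_sum. Qed.

Lemma phiXn N n f : (0 < N)%N -> (N <= n)%N -> phi N ('X^n * f) = 0.
Proof.
move=> N0 Nn; rewrite /phi -mulrA coefXnM.
by case: ltnP => //; lia.
Qed.

(** Since 1 / (1 + X + X^2) = (1 - X) / (1 - X^3), the coefficients 1, -1, 0 repeat; truncation
    affects only the coefficients of index at least N. *)
Lemma chi_polyM N i : (i < N)%N ->
  ((1 + 'X + 'X^2) * chi_poly N)`_i = (i == 0%N)%:R.
Proof.
move=> iN; rewrite !mulrDl mul1r coefD coefD coefXM coefXnM !coef_poly iN.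
case: i iN => [|[|i]] iN /=; rewrite ?ltnS.
- by rewrite /chi /= !addr0.
- by rewrite (ltnW iN) /chi /= addr0 addrC subrr.
rewrite subn2 /= !(ltnW iN) (ltnW (ltnW iN)).
by rewrite addrC [chi R i.+3 + _]addrC addrA chi_sum3.
Qed.

Lemma phi_cyclo N f : (0 < N)%N -> phi N (f * (1 + 'X + 'X^2)) = f`_N.-1.
Proof.
case: N => // N _; rewrite /phi -mulrA coefM /= big_ord_recr /= subnn.
rewrite chi_polyM // mulr1 big1 ?add0r // => i _.
by rewrite chi_polyM ?ltnS ?leq_subr // subn_eq0 leqNgt ltn_ord mulr0.
Qed.

End Phi.

Lemma phi_map (R S : comNzRingType) (h : {rmorphism R -> S}) N (f : {poly R}) :
  (0 < N)%N -> phi N (map_poly h f) = h (phi N f).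
Proof.
move=> N0; rewrite !phiE // rmorph_sum /=; apply: eq_bigr => j _.
by rewrite rmorphM /= rmorph_chi coef_map.
Qed.

Lemma coef_addCXn (R : comNzRingType) (c : R) n k :
  ((c%:P + 'X) ^+ n)`_k = 'C(n, k)%:R * c ^+ (n - k).
Proof.
rewrite exprDn coef_sum.
under eq_bigr do rewrite -polyC_exp coefMn coefCM coefXn.
case: (ltnP k n.+1) => kn.
  rewrite (bigD1 (Ordinal kn)) //= eqxx mulr1 mulr_natl big1 ?addr0 // => i /eqP ik.
  by case: eqP => [e|_]; [case: ik; apply/val_inj|rewrite mulr0 mul0rn].
rewrite bin_small // mul0r big1 // => i _; case: eqP => [e|_].
  by move: (ltn_ord i); rewrite -e ltnNge kn.
by rewrite mulr0 mul0rn.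
Qed.

Lemma coef_X1n (R : comNzRingType) (n k : nat) :
  ((1 + 'X) ^+ n : {poly R})`_k = 'C(n, k)%:R.
Proof. by rewrite -polyC1 coef_addCXn expr1n mulr1. Qed.

(** * Binomial sums *)

Section PhiBinomial.
Variable R : comNzRingType.
Local Notation x := ('X : {poly R}).
Local Notation s := (1 + 'X : {poly R}).

(** With i = p - k - l the argument is x^l s^(k+l) ((s^2)^i - x^i), a multiple of s^2 - x = 1 + x +
    x^2; [phi_cyclo] then reads a coefficient of the geometric quotient. *)
Lemma phi_sum_bin p k l : (k + l < p)%N ->
  phi p (x ^+ l * s ^+ (p + p - (k + l)) - x ^+ (p - k) * s ^+ (k + l)) =
  \sum_(e < p - (k + l)) 'C(k + l + (e + e), k + e)%:R.
Proof.
move=> klp; have [i iE] : {i | (p - (k + l))%N = i} by exists (p - (k + l))%N.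
rewrite iE.
have -> : (p + p - (k + l) = i + i + (k + l))%N by lia.
have -> : (p - k = l + i)%N by lia.
have -> : x ^+ l * s ^+ (i + i + (k + l)) - x ^+ (l + i) * s ^+ (k + l) =
    (\sum_(e < i) x ^+ (l + (i.-1 - e)) * s ^+ (k + l + (e + e))) * (1 + x + x ^+ 2).
  transitivity (- (x ^+ l * s ^+ (k + l) * (x ^+ i - (s ^+ 2) ^+ i))).
    rewrite (exprD s) (exprD x) -exprM mul2n addnn; ring.
  rewrite subrXX mulrCA -mulNr mulr_sumr mulrC; congr (_ * _); last by ring.
  by apply: eq_bigr => e _; rewrite (exprD x) (exprD s (k + l)) -exprM mul2n addnn mulrACA.
rewrite phi_cyclo; last by lia.
rewrite coef_sum; apply: eq_bigr => e _; have := ltn_ord e => ei.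
rewrite coefXnM; case: ltnP => [|_]; first by lia.
by rewrite coef_X1n; congr ('C(_, _)%:R); lia.
Qed.

(** For i = p - k - l, the polynomial s + x^2 = 1 + x + x^2 divides s^i - (-x^2)^i, and the leftover
    has a factor x^(p+i), which [phi] kills. *)
Lemma phi_XnMX1n p k l : (k + l < p)%N ->
  phi p (x ^+ (k + l) * s ^+ (p - l)) =
  \sum_(e < p - (k + l)) (-1) ^+ e * 'C(p - l.+1 - e, k + e)%:R.
Proof.
move=> klp; have [i iE] : {i | (p - (k + l))%N = i} by exists (p - (k + l))%N.
rewrite iE.
have -> : (p - l = i + k)%N by lia.
have -> : x ^+ (k + l) * s ^+ (i + k) =
   (\sum_(e < i) (-1) ^+ e * (x ^+ (k + l + (e + e)) * s ^+ (p - l.+1 - e))) * (1 + x + x ^+ 2)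
   + x ^+ (k + l + (i + i)) * ((-1) ^+ i * s ^+ k).
  transitivity (x ^+ (k + l) * s ^+ k * (s ^+ i - (- x ^+ 2) ^+ i)
    + x ^+ (k + l + (i + i)) * ((-1) ^+ i * s ^+ k)).
    rewrite [(- x ^+ 2) ^+ i]exprNn -exprM mul2n addnn !exprD; ring.
  congr (_ + _); rewrite subrXX mulrCA mulrC mulr_sumr; congr (_ * _); last by ring.
  apply: eq_bigr => e _; rewrite [(- x ^+ 2) ^+ e]exprNn -exprM mul2n -addnn.
  have -> : (p - l.+1 - e = k + (i.-1 - e))%N.
    by have := ltn_ord e; lia.
  rewrite !exprD; ring.
rewrite phiD phiXn ?addr0; [|lia|lia].
rewrite phi_cyclo; last by lia.
rewrite coef_sum; apply: eq_bigr => e _; have := ltn_ord e => ei.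
rewrite -[in LHS]signr_odd -[in RHS]signr_odd !mulr_sign.
suff E : (x ^+ (k + l + (e + e)) * s ^+ (p - l.+1 - e))`_p.-1 = 'C(p - l.+1 - e, k + e)%:R.
  by case: ifP => _; rewrite ?coefN E.
(* For k + l + 2e >= p the coefficient is 0, and so is the binomial, whose lower index exceeds the
   upper one. *)
rewrite coefXnM; case: ltnP => ke.
  by rewrite bin_small //; lia.
rewrite coef_X1n -bin_sub; last by lia.
by congr ('C(_, _)%:R); lia.
Qed.

End PhiBinomial.

(** * Reflection of binomial coefficients modulo p *)

Lemma natr_ffact (R : pzRingType) n j :
  (n ^_ j)%:R = \prod_(t < j) (n%:R - t%:R) :> R.
Proof.
elim: j => [|j IHj]; first by rewrite ffactn0 big_ord0.
rewrite ffactnSr natrM big_ord_recr /= -IHj.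
case: (leqP j n) => [jn | nj]; first by rewrite natrB.
by rewrite ffact_small // !mul0r.
Qed.

Lemma natr_neq0_pchar (F : fieldType) p n :
  p \in [pchar F] -> (0 < n < p)%N -> n%:R != 0 :> F.
Proof.
move=> pF /andP[n0 np]; rewrite -(dvdn_pcharf pF).
by apply/negP => /(dvdn_leq n0); rewrite leqNgt np.
Qed.

(** Modulo p, the j factors N - t of the falling factorial of N, negated and taken in reverse order,
    are those of p + j - N - 1. Here j < p makes j! invertible. *)
Lemma bin_reflect (F : fieldType) p N j :
  p \in [pchar F] -> (j < p)%N -> (N < p + j)%N ->
  'C(N, j)%:R = (-1) ^+ j * 'C(p + j - N.+1, j)%:R :> F.
Proof.
move=> pF jp Np.
have fact_neq0 : j`!%:R != 0 :> F.
  rewrite -(dvdn_pcharf pF); have pp := pcharf_prime pF.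
  elim: j jp {Np} => [|j IHj] jp; first by rewrite fact0 dvdn1 neq_ltn (prime_gt1 pp) orbT.
  rewrite factS Euclid_dvdM // negb_or (IHj (ltnW jp)) andbT.
  by apply/negP => /(dvdn_leq (ltn0Sn _)); rewrite leqNgt jp.
apply: (mulIf fact_neq0); rewrite -mulrA -!natrM !bin_ffact !natr_ffact.
rewrite -[in (-1) ^+ j](card_ord j) -prodr_const -big_split /=.
rewrite [RHS](reindex_inj rev_ord_inj) /=; apply: eq_bigr => t _.
have tj := ltn_ord t.
rewrite natrB // [(p + j)%:R]natrD (pcharf0 pF) natrB // -!natr1; ring.
Qed.

(** * The alternating sum of Franel numbers *)

Lemma sum_triangle (V : nmodType) (n : nat) (g : nat -> nat -> V) :
  \sum_(j < n) \sum_(k < j.+1) g k (j - k)%N =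
  \sum_(k < n) \sum_(l < n - k) g k l.
Proof.
elim: n => [|n IHn]; first by rewrite !big_ord0.
rewrite big_ord_recr /= IHn [RHS]big_ord_recr /= subSnn big_ord1.
rewrite big_ord_recr /= subnn addrA; congr (_ + _).
rewrite -big_split; apply: eq_bigr => k _ /=.
by rewrite subSn ?(ltnW (ltn_ord k)) // big_ord_recr.
Qed.

(** Geometric expansion of F / (a + b X), with denominators cleared because a need not be
    invertible. *)
Lemma coef_divp_linear (R : comNzRingType) (a b : R) (U F : {poly R}) (n : nat) :
  (a%:P + b *: 'X) * U = F ->
  a ^+ n.+1 * U`_n = \sum_(j < n.+1) F`_j * (- b) ^+ (n - j) * a ^+ j.
Proof.
move=> <-; elim: n => [|n IHn].
  by rewrite big_ord1 expr1 subnn !mulr1 mulrDl -scalerAl coefD coefCM coefZ coefXM mulr0 addr0.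
rewrite big_ord_recr /= subnn mulr1 [in X in _ = _ + X * _]mulrDl coefD coefCM -scalerAl coefZ coefXM /=.
under eq_bigr => j _ do
  rewrite (subSn (ltn_ord j : (j <= n)%N)) exprS mulrCA -mulrA.
rewrite -big_distrr /= -IHn [a ^+ n.+2]exprS; ring.
Qed.

Section Franel.
Local Notation x := ('X : {poly int}).
Local Notation s := (1 + 'X : {poly int}).
Local Notation y := ('X : {poly {poly int}}).

(** The outer coefficient is taken in y, the inner one in x. *)
Let w : {poly {poly int}} := (x%:P + y) * s%:P * (1 + y).

Lemma coef_w n j :
  (w ^+ n)`_j = s ^+ n * \sum_(k < j.+1) ('C(n, k) * 'C(n, j - k))%:R * x ^+ (n - k).
Proof.
rewrite !exprMn -polyC_exp mulrAC [_ * _%:P]mulrC coefCM; congr (_ * _).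
rewrite coefM; apply: eq_bigr => k _; rewrite coef_addCXn.
by rewrite -polyC1 coef_addCXn expr1n mulr1 natrM mulrAC.
Qed.

Lemma diag_coef_w n : (w ^+ n)`_n`_n = (franel n)%:R.
Proof.
rewrite coef_w mulr_sumr coef_sum natr_sum; apply: eq_bigr => k _.
have kn : (k <= n)%N by rewrite -ltnS.
rewrite mulrCA mulr_natl coefMn coefMXn ltnNge leq_subr /= subKn //.
by rewrite coef_X1n bin_sub // -mulrnA -[3%N]/(1 + 2)%N expnD expn1 -mulnn.
Qed.

(** For odd p this is (w^p + (xy)^p) / (w + xy). The powers of xy move the diagonal coefficients of
    all w^n to the same monomial x^(p-1) y^(p-1). *)
Let H p : {poly {poly int}} :=
  \sum_(n < p) (x%:P * y) ^+ (p.-1 - n) * (- w) ^+ n.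

Lemma diag_coef_H p : (0 < p)%N ->
  (H p)`_p.-1`_p.-1 = \sum_(n < p) (-1) ^+ n * (franel n)%:R.
Proof.
move=> p0; rewrite !coef_sum; apply: eq_bigr => n _.
have np : (n <= p.-1)%N by have := ltn_ord n; lia.
rewrite exprMn -polyC_exp [(- w) ^+ n]exprNn -mulrA coefCM coefXnM ltnNge leq_subr /=.
rewrite subKn // coefXnM ltnNge leq_subr /= subKn //.
by rewrite -[in LHS]signr_odd -[in RHS]signr_odd !mulr_sign; case: ifP => _;
  rewrite ?coefN ?diag_coef_w ?mulN1r ?mul1r.
Qed.

Lemma H_factor p : odd p ->
  (x%:P + s *: y) * ((s%:P + 1 *: y) * H p) = w ^+ p + (x%:P * y) ^+ p.
Proof.
move=> podd; transitivity ((x%:P * y - (- w)) * H p).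
  rewrite mulrA; congr (_ * _); rewrite -!mul_polyC /w !polyCD polyC1; ring.
by rewrite -subrXX exprNn -signr_odd podd expr1 mulN1r opprK addrC.
Qed.

Lemma coef_H_factor p j : odd p -> (j < p)%N ->
  (w ^+ p + (x%:P * y) ^+ p)`_j =
  s ^+ p * \sum_(k < j.+1) ('C(p, k) * 'C(p, j - k))%:R * x ^+ (p - k).
Proof.
move=> podd jp; rewrite coefD [(x%:P * y) ^+ p]exprMn -polyC_exp coefCM coefXn.
by rewrite ltn_eqF // mulr0 addr0 coef_w.
Qed.

(** Partial fractions: for U = (s + y) H and V = (x + s y) H, the combination s U - V = (s^2 - x) H
    = (1 + x + x^2) H is free of y in its factor. [coef_divp_linear] gives the coefficients of U and
    V up to factors x^p and s^p, which are cancelled. *)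
Lemma franel_poly_identity p : odd p ->
  (H p)`_p.-1 * (1 + x + x ^+ 2) =
  \sum_(k < p) \sum_(l < p - k) ((-1) ^+ (k + l) * ('C(p, k) * 'C(p, l))%:R)%:P *
    (x ^+ l * s ^+ (p + p - (k + l)) - x ^+ (p - k) * s ^+ (k + l)).
Proof.
move=> podd; case: p podd => // n podd.
have neven : odd n = false by apply/negbTE.
have fact := H_factor podd; set h := H n.+1 in fact *.
have fact' : (s%:P + 1 *: y) * ((x%:P + s *: y) * h) = w ^+ n.+1 + (x%:P * y) ^+ n.+1.
  by rewrite mulrCA.
have EU := coef_divp_linear n fact; have EV := coef_divp_linear n fact'.
have -> : h`_n * (1 + x + x ^+ 2) =
    s * ((s%:P + 1 *: y) * h)`_n - ((x%:P + s *: y) * h)`_n.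
  rewrite !mulrDl !coefD !coefCM -!scalerAl !coefZ; ring.
set g : nat -> nat -> {poly int} := fun k l =>
  ((-1) ^+ (k + l) * ('C(n.+1, k) * 'C(n.+1, l))%:R)%:P.
have sgn j : (j <= n)%N -> (-1) ^+ (n - j) = (-1) ^+ j :> {poly int}.
  by move=> jn; rewrite -signr_odd oddB // neven signr_odd.
have gE j (k : 'I_j.+1) : g k (j - k)%N =
    (-1) ^+ j * ('C(n.+1, k) * 'C(n.+1, j - k))%:R.
  have kj : (k <= j)%N by rewrite -ltnS.
  by rewrite /g subnKC // (rmorphM (@polyC int)) (rmorph_sign (@polyC int)) (rmorph_nat (@polyC int)).
have -> : s * ((s%:P + 1 *: y) * h)`_n =
  \sum_(k < n.+1) \sum_(l < n.+1 - k)
     g k l * (x ^+ l * s ^+ (n.+1 + n.+1 - (k + l))).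
  rewrite -(sum_triangle n.+1 (fun k l => g k l * (x ^+ l * s ^+ (n.+1 + n.+1 - (k + l))))).
  have x0 : x != 0 by rewrite polyX_eq0.
  apply: (mulfI (expf_neq0 n.+1 x0)).
  rewrite mulrCA EU !mulr_sumr; apply: eq_bigr => j _.
  rewrite coef_H_factor // !(mulr_suml, mulr_sumr); apply: eq_bigr => k _.
  have kj : (k <= j)%N by rewrite -ltnS.
  have jn : (j <= n)%N by rewrite -ltnS.
  rewrite gE subnKC // [(- s) ^+ _]exprNn sgn //.
  have -> : (n.+1 + n.+1 - j = 1 + n.+1 + (n - j))%N by lia.
  have ex : x ^+ (n.+1 - k) * x ^+ j = x ^+ n.+1 * x ^+ (j - k).
    by rewrite -!exprD; congr (_ ^+ _); lia.
  rewrite !(exprD s) expr1; move: ex.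
  move: (x ^+ (n.+1 - k)) (x ^+ j) (x ^+ n.+1) (x ^+ (j - k)) ((-1) ^+ j : {poly int}).
  move: s (s ^+ n.+1) (s ^+ (n - j)) (_%:R) => s3 s1 s2 c a1 a2 a3 a4 e ex.
  transitivity (e * c * (s3 * s1 * s2) * (a1 * a2)); first by ring.
  rewrite ex; ring.
have -> : ((x%:P + s *: y) * h)`_n =
  \sum_(k < n.+1) \sum_(l < n.+1 - k) g k l * (x ^+ (n.+1 - k) * s ^+ (k + l)).
  rewrite -(sum_triangle n.+1 (fun k l => g k l * (x ^+ (n.+1 - k) * s ^+ (k + l)))).
  have s0 : s != 0 by rewrite addrC -polyC1 monic_neq0 // monicXaddC.
  apply: (mulfI (expf_neq0 n.+1 s0)).
  rewrite EV !mulr_sumr; apply: eq_bigr => j _.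
  rewrite coef_H_factor // !(mulr_suml, mulr_sumr); apply: eq_bigr => k _.
  have kj : (k <= j)%N by rewrite -ltnS.
  have jn : (j <= n)%N by rewrite -ltnS.
  rewrite gE subnKC // sgn //.
  move: (x ^+ _) ((-1) ^+ j : {poly int}) (s ^+ _) (s ^+ _) (_%:R) => a1 e s1 s2 c.
  ring.
rewrite -sumrB; apply: eq_bigr => k _; rewrite -sumrB; apply: eq_bigr => l _.
by rewrite mulrBr.
Qed.

Lemma sum_franel p : odd p ->
  \sum_(n < p) (-1) ^+ n * (franel n)%:R =
  \sum_(k < p) \sum_(l < p - k) (-1) ^+ (k + l) * ('C(p, k) * 'C(p, l))%:R *
    phi p (x ^+ l * s ^+ (p + p - (k + l)) - x ^+ (p - k) * s ^+ (k + l)).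
Proof.
move=> podd; have p0 := odd_gt0 podd.
rewrite -diag_coef_H // -phi_cyclo // franel_poly_identity // phi_sum.
apply: eq_bigr => k _; rewrite phi_sum; apply: eq_bigr => l _.
by rewrite phiMC.
Qed.

End Franel.

(** * Splitting off the multiples of p *)

(** This is (1 + z^2)^n = (-z)^n for a primitive cube root of unity z, as [chi] is a combination of
    the powers of z and 1/z. The induction uses Pascal's rule instead. *)
Lemma sum_bin_chi (R : pzRingType) n t :
  \sum_(k < n.+1) 'C(n, k)%:R * chi R (t + (k + k)) = (-1) ^+ n * chi R (t + n).
Proof.
elim: n t => [|n IHn] t; first by rewrite big_ord1 bin0 addn0.
have -> : (-1) ^+ n.+1 * chi R (t + n.+1) = (-1) ^+ n * chi R (t + n) + (-1) ^+ n * chi R (t.+2 + n).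
  rewrite -mulrDr exprSr -mulrA mulN1r; congr (_ * _).
  by apply/esym/eqP; rewrite addnS !addSn -addr_eq0 addrAC chi_sum3.
rewrite -!IHn big_ord_recl [X in _ = X + _]big_ord_recl /= !bin0 -addrA; congr (_ + _).
transitivity (\sum_(k < n.+1) 'C(n, k.+1)%:R * chi R (t + (k.+1 + k.+1)) +
    \sum_(k < n.+1) 'C(n, k)%:R * chi R (t.+2 + (k + k))).
  rewrite -big_split; apply: eq_bigr => k _ /=.
  rewrite binS natrD mulrDl; congr (_ * _ + _ * _).
  by rewrite /bump /=; congr chi; lia.
by rewrite big_ord_recr /= bin_small // mul0r addr0.
Qed.

(* Since p > 1, the value at k = 0 is 0. *)
Definition binp (p k : nat) : nat := ('C(p, k) %/ p)%N.

Lemma bin_prime p k : prime p -> (k < p)%N ->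
  'C(p, k) = ((k == 0) + p * binp p k)%N.
Proof.
move=> pp kp; rewrite /binp; case: posnP => [->|k0].
  by rewrite bin0 divn_small ?prime_gt1 // muln0.
by rewrite mulnC divnK // prime_dvd_bin // k0.
Qed.

Lemma binp0 p : prime p -> binp p 0 = 0%N.
Proof. by move=> pp; rewrite /binp bin0 divn_small ?prime_gt1. Qed.

(** The binomial theorem without its two extreme terms. *)
Lemma sum_binp (S : comNzRingType) p (a b : S) : prime p ->
  p%:R * (\sum_(k < p) (binp p k)%:R * (a ^+ k * b ^+ (p - k))) =
  (a + b) ^+ p - a ^+ p - b ^+ p.
Proof.
move=> pp; rewrite [a + b]addrC exprDn big_ord_recr /= subnn mul1r binn mulr1n addrK.
rewrite mulr_sumr -(prednK (prime_gt0 pp)) !big_ord_recl /=.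
rewrite binp0 ?prednK ?prime_gt0 // mul0r mulr0 add0r subn0 mulr1 bin0 mulr1n.
rewrite addrC addrK; apply: eq_bigr => k _.
have kp : (bump 0 k < p)%N by rewrite /bump /=; have := ltn_ord k; lia.
by rewrite bin_prime //= add0n -[RHS]mulr_natl natrM mulrA [a ^+ _ * _]mulrC.
Qed.

(** This is ((1 + X)^p - 1 - X^p) / p, given by coefficients so that it makes sense in
    characteristic p. *)
Definition Gpoly (R : nzRingType) p : {poly R} := \poly_(k < p) (binp p k)%:R.

Lemma GpolyE (R : nzRingType) p : Gpoly R p = \sum_(k < p) (binp p k)%:R * 'X^k.
Proof.
rewrite /Gpoly poly_def; apply: eq_bigr => k _.
by rewrite -mul_polyC rmorph_nat.
Qed.

Lemma Gpoly_def (R : comNzRingType) p : prime p ->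
  p%:R * Gpoly R p = (1 + 'X) ^+ p - 1 - 'X^p.
Proof.
move=> pp; have := sum_binp ('X : {poly R}) 1 pp.
rewrite expr1n [_ + 1]addrC addrAC => <-; rewrite GpolyE; congr (_ * _).
by apply: eq_bigr => k _; rewrite expr1n mulr1.
Qed.

Section Exact.
Variable p : nat.
Hypotheses (pp : prime p) (p3 : (3 < p)%N).
Local Notation x := ('X : {poly int}).
Local Notation s := (1 + 'X : {poly int}).
Local Notation G := (Gpoly int p).
Local Notation g := (binp p).

Let p0 : (0 < p)%N := prime_gt0 pp.

Lemma odd_prime_gt3 : odd p.
Proof. by apply: contraLR p3 => /prime_oddPn-/(_ pp) ->. Qed.

Let podd := odd_prime_gt3.

Lemma prime_gt3_mod3 : (p %% 3 != 0)%N.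
Proof.
rewrite -/(3 %| p)%N (dvdn_prime2 _ pp) //.
by rewrite neq_ltn p3.
Qed.

Let pn0 : p%:R != 0 :> int. Proof. by rewrite pnatr_eq0 -lt0n. Qed.

(** Removing the terms k = 0 and k = p from [sum_bin_chi] leaves minus the sum of [chi] at t, t + p,
    t + 2p, which represent all classes modulo 3. *)
Lemma sum_binp_chi t : \sum_(k < p) (g k)%:R * chi int (t + (k + k)) = 0.
Proof.
apply: (mulfI pn0); rewrite mulr0 mulr_sumr.
have := sum_bin_chi int p t; rewrite big_ord_recr /= binn mul1r.
rewrite (eq_bigr (fun k : 'I_p => (k == 0%N :> nat)%:R * chi int t +
  p%:R * ((g k)%:R * chi int (t + (k + k))))); last first.
  move=> k _; rewrite bin_prime // natrD natrM mulrDl mulrA; congr (_ + _).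
  by case: eqP => [->|]; rewrite ?addn0 // !mul0r.
rewrite big_split /= -mulr_suml.
have -> : \sum_(k < p) ((k == 0%N :> nat)%:R : int) = 1.
  by rewrite (bigD1 (Ordinal p0)) //= big1 ?addr0 // => i /negbTE; rewrite -val_eqE /= => ->.
rewrite -signr_odd podd expr1 mul1r mulN1r.
have : chi int t + chi int (t + p) + chi int (t + (p + p)) = 0.
  have := prime_gt3_mod3; rewrite /chi => ?.
  by repeat (case: eqP => ?); try (exfalso; lia).
move: (chi _ t) (chi _ (t + p)) (chi _ (t + (p + p))) (\sum_(k < p) _).
by move=> a b c d; lia.
Qed.

Lemma phi1 : phi p (1 : {poly int}) = chi int p.
Proof.
rewrite phiE // (bigD1 (Ordinal p0)) //= coef1 mul1r subn0 big1 ?addr0 // => i.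
by rewrite -val_eqE coef1 /= => /negbTE ->; rewrite mul0r.
Qed.

Lemma phi_Gpoly : phi p G = 0.
Proof.
rewrite phiE // -[RHS](sum_binp_chi p); apply: eq_bigr => k _.
rewrite coef_poly ltn_ord; congr (_ * _); apply: chi_mod; have := ltn_ord k; lia.
Qed.

Lemma X1p : s ^+ p = 1 + p%:R%:P * G + x ^+ p * 1.
Proof. by rewrite rmorph_nat Gpoly_def //; ring. Qed.

Lemma phi_X1p : phi p (s ^+ p) = chi int p.
Proof. by rewrite X1p !phiD phiMC phi_Gpoly mulr0 addr0 phiXn // addr0 phi1. Qed.

(** Modulo x^p one has s^p = 1 + p G, so s^(2p) = 2 s^p - 1 + p^2 G^2. *)
Lemma phi_X12p : phi p (s ^+ p * s ^+ p) = chi int p + p%:R ^+ 2 * phi p (G * G).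
Proof.
have -> : s ^+ p * s ^+ p = s ^+ p + s ^+ p - 1 + (p%:R ^+ 2)%:P * (G * G)
   + x ^+ p * (x ^+ p + (p%:R * G) *+ 2).
  by rewrite X1p [(p%:R ^+ 2)%:P]rmorphXn /= rmorph_nat; ring.
rewrite !(phiD, phiN) phiMC phi_X1p phi1 phiXn // addr0; ring.
Qed.

(* p^2 tau collects the terms of sum_franel with k, l > 0. *)
Definition tau : int := \sum_(k < p) \sum_(l < p - k)
  (-1) ^+ (k + l) * (g k * g l)%:R *
    phi p (x ^+ l * s ^+ (p + p - (k + l)) - x ^+ (p - k) * s ^+ (k + l)).

(** Expand both binomials as C(p,k) = [k = 0] + p g(k). The corner k = l = 0 gives phi(s^(2p)), each
    of the two edges gives chi(p) - phi(s^(2p)), and the interior gives p^2 tau. *)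
Lemma alt_sum_franel :
  \sum_(n < p) (-1) ^+ n * (franel n)%:R =
  chi int p + p%:R ^+ 2 * (tau - phi p (G * G)).
Proof.
rewrite sum_franel //.
pose d (k : nat) : int := (k == 0%N)%:R.
pose b k l := phi p (x ^+ l * s ^+ (p + p - (k + l)) - x ^+ (p - k) * s ^+ (k + l)).
have sum_d n (F : nat -> int) : (0 < n)%N -> \sum_(k < n) d k * F k = F 0%N.
  case: n => // n _; rewrite big_ord_recl /= big1 => [|k _]; last by rewrite /d mul0r.
  by rewrite /d mul1r addr0.
transitivity (\sum_(k < p) (d k * (\sum_(l < p - k) d l * b 0%N 0%N) +
  d k * (\sum_(l < p - k) (-1) ^+ l * (p%:R * (g l)%:R) * b 0%N l) +
  (-1) ^+ k * (p%:R * (g k)%:R) * (\sum_(l < p - k) d l * b k 0%N) +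
  p%:R ^+ 2 * \sum_(l < p - k) (-1) ^+ (k + l) * (g k * g l)%:R * b k l)).
  apply: eq_bigr => k _; rewrite !mulr_sumr -!big_split; apply: eq_bigr => l _ /=.
  have lp : (l < p)%N by have := ltn_ord l; lia.
  have := ltn_ord k; move: (nat_of_ord k) (nat_of_ord l) lp => {l}k l lp kp.
  rewrite !bin_prime // -/(b k l) natrM !natrD !natrM -/(d k) -/(d l) exprD.
  rewrite /d; case: eqP => [->|_]; case: eqP => [->|_]; rewrite ?expr0 /=; ring.
rewrite !big_split /= -mulr_sumr -/tau.
rewrite (sum_d _ (fun k => \sum_(l < p - k) d l * b 0%N 0%N)) //.
rewrite (sum_d _ (fun k => \sum_(l < p - k) (-1) ^+ l * (p%:R * (g l)%:R) * b 0%N l)) // subn0.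
rewrite (sum_d _ (fun=> b 0%N 0%N)) //.
have -> : b 0%N 0%N = phi p (s ^+ p * s ^+ p).
  by rewrite /b expr0 mul1r !subn0 phiB [X in _ - X]phiXn // subr0 exprD.
(* Edge k = 0: [sum_binp] at a = -x, b = s, where a + b = 1. *)
have -> : \sum_(l < p) (-1) ^+ l * (p%:R * (g l)%:R) * b 0%N l =
    chi int p - phi p (s ^+ p * s ^+ p).
  transitivity (phi p ((p%:R * \sum_(l < p) (g l)%:R * ((- x) ^+ l * s ^+ (p - l))) * s ^+ p)).
    rewrite !(mulr_sumr, mulr_suml) phi_sum; apply: eq_bigr => l _.
    rewrite /b phiB [X in _ - X]phiXn // ?subn0 // subr0 -phiMC; congr phi.
    rewrite !rmorphM /= (rmorph_sign (@polyC int)) !(rmorph_nat (@polyC int)).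
    have -> : (p + p - (0 + l) = p - l + p)%N by have := ltn_ord l; lia.
    rewrite exprD [(- x) ^+ l]exprNn; ring.
  rewrite sum_binp // [- x + s]addrC addrK expr1n [(- x) ^+ p]exprNn -signr_odd podd expr1.
  have -> : (1 - -1 * x ^+ p - s ^+ p) * s ^+ p = s ^+ p - s ^+ p * s ^+ p + x ^+ p * s ^+ p by ring.
  by rewrite phiD phiB phiXn // addr0 phi_X1p.
(* Edge l = 0: [sum_binp] at (-1, s) and at (-s, x), with sums x and -1. *)
have -> : \sum_(k < p) (-1) ^+ k * (p%:R * (g k)%:R) * (\sum_(l < p - k) d l * b k 0%N) =
    chi int p - phi p (s ^+ p * s ^+ p).
  transitivity (phi p ((p%:R * \sum_(k < p) (g k)%:R * ((-1) ^+ k * s ^+ (p - k))) * s ^+ p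
     - p%:R * \sum_(k < p) (g k)%:R * ((- s) ^+ k * x ^+ (p - k)))).
    rewrite !(mulr_sumr, mulr_suml) -sumrB phi_sum; apply: eq_bigr => k _.
    rewrite (sum_d _ (fun=> b k 0%N)) ?subn_gt0 // /b -phiMC; congr phi.
    rewrite !rmorphM /= (rmorph_sign (@polyC int)) !(rmorph_nat (@polyC int)).
    have -> : (p + p - (k + 0) = p - k + p)%N by have := ltn_ord k; lia.
    rewrite exprD [(- s) ^+ k]exprNn addn0; ring.
  rewrite !sum_binp // addKr.
  have -> : - s + x = -1 by ring.
  rewrite [(- s) ^+ p]exprNn -signr_odd podd expr1.
  have -> : (x ^+ p - -1 - s ^+ p) * s ^+ p - (-1 - -1 * s ^+ p - x ^+ p) =
    1 - s ^+ p * s ^+ p + x ^+ p * (s ^+ p + 1) by ring.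
  by rewrite phiD phiB phiXn // addr0 phi1.
rewrite phi_X12p; ring.
Qed.

End Exact.

(** * The remaining double sum modulo p *)

Section ModP.
Variable p : nat.
Hypotheses (pp : prime p) (p3 : (3 < p)%N).
Local Notation F := 'F_p.
Local Notation x := ('X : {poly F}).
Local Notation s := (1 + 'X : {poly F}).
Local Notation g := (binp p).
Let pF : p \in [pchar F] := pchar_Fp pp.
Let p0 : (0 < p)%N := prime_gt0 pp.
Let podd : odd p := odd_prime_gt3 pp p3.

(** For k > 0, C(p,k) / p = C(p-1,k-1) / k and C(p-1,k-1) = (-1)^(k-1) modulo p. At k = 0 both sides
    vanish, as 0^-1 = 0. *)
Lemma binp_modp k : (k < p)%N -> (g k)%:R = - ((-1) ^+ k * (k%:R)^-1) :> F.
Proof.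
case: k => [|k] kp; first by rewrite binp0 // invr0 mulr0 oppr0.
have k0 : k.+1%:R != 0 :> F by rewrite (natr_neq0_pchar pF).
apply: (mulfI k0); rewrite -natrM.
have -> : (k.+1 * g k.+1 = 'C(p.-1, k))%N.
  apply/eqP; rewrite -(eqn_pmul2l p0) mulnCA -[(p * g _)%N]add0n.
  by rewrite -(bin_prime pp kp) -{1}(prednK p0) mul_bin_diag prednK.
rewrite (bin_reflect pF) ?prednK ?(ltnW kp) //; last by lia.
by rewrite addKn binn mulr1 exprS mulN1r mulNr opprK mulrC mulfVK.
Qed.

Lemma map_Gpoly (R S : nzRingType) (f : {rmorphism R -> S}) :
  map_poly f (Gpoly R p) = Gpoly S p.
Proof.
rewrite !GpolyE rmorph_sum; apply: eq_bigr => k _.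
by rewrite rmorphM rmorph_nat /= map_polyXn.
Qed.

Lemma sum_X_binp (R : comNzRingType) :
  \sum_(l < p) (-1) ^+ l * (g l)%:R * ('X^l * (1 + 'X) ^+ (p - l)) = - Gpoly R p.
Proof.
(* It suffices to work over the integers, where p can be cancelled. *)
suff E : \sum_(l < p) (-1) ^+ l * (g l)%:R * ('X^l * (1 + 'X) ^+ (p - l)) = - Gpoly int p.
  have := congr1 (map_poly (intr : int -> R)) E.
  rewrite rmorphN /= map_Gpoly => <-; rewrite rmorph_sum; apply: eq_bigr => l _.
  by rewrite !rmorphM rmorph_sign rmorph_nat !rmorphXn rmorphD rmorph1 /= map_polyX.
have pn0 : (p%:R : {poly int}) != 0.
  by rewrite -(rmorph_nat (@polyC int)) polyC_eq0 pnatr_eq0 -lt0n.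
apply: (mulfI pn0); rewrite mulrN Gpoly_def //.
transitivity (p%:R * \sum_(l < p) (g l)%:R * ((- 'X : {poly int}) ^+ l * (1 + 'X) ^+ (p - l))).
  by congr (_ * _); apply: eq_bigr => l _; rewrite [(- 'X) ^+ l]exprNn; ring.
rewrite sum_binp // [- 'X + _]addrC addrK expr1n [(- 'X) ^+ p]exprNn -signr_odd podd; ring.
Qed.

(* By bin_reflect the sums of phi_sum_bin and phi_XnMX1n agree up to sign, term
   by term modulo p, so the double sum tau factors. *)
Lemma tau_modp : (tau p)%:~R = - phi p (Gpoly F p * Gpoly F p).
Proof.
transitivity (\sum_(k < p) \sum_(l < p - k)
    (g k)%:R * ((-1) ^+ l * (g l)%:R * phi p (x ^+ (k + l) * s ^+ (p - l)))).
  rewrite /tau rmorph_sum; apply: eq_bigr => k _; rewrite rmorph_sum; apply: eq_bigr => l _ /=.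
  have klp : (k + l < p)%N by have := ltn_ord l; lia.
  rewrite phi_sum_bin // phi_XnMX1n // natrM !rmorphM rmorph_sign !rmorph_nat rmorph_sum /=.
  rewrite exprD -!mulrA mulr_sumr !mulr_sumr; apply: eq_bigr => e _.
  have ep : (e < p - (k + l))%N := ltn_ord e.
  rewrite rmorph_nat (bin_reflect pF); [|lia|lia].
  have -> : (p + (k + e) - (k + l + (e + e)).+1 = p - l.+1 - e)%N by lia.
  rewrite exprD -[in (-1) ^+ k]signr_odd; case: (odd k); rewrite /= ?expr1 ?expr0; ring.
(* Pairs with k + l >= p may be added, since [phi] kills x^(k+l); the sum over the full square is a
   product. *)
transitivity (\sum_(k < p) \sum_(l < p)
    (g k)%:R * ((-1) ^+ l * (g l)%:R * phi p (x ^+ (k + l) * s ^+ (p - l)))).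
  apply: eq_bigr => k _; have kp : (p - k <= p)%N by lia.
  pose t l := (g k)%:R * ((-1) ^+ l * (g l)%:R * phi p (x ^+ (k + l) * s ^+ (p - l))).
  rewrite (big_ord_widen_cond p predT t kp) -/t /= [RHS](bigID (fun l : 'I_p => (l < p - k)%N)) /=.
  rewrite [X in _ + X]big1 ?addr0 // => l; rewrite -leqNgt => kl.
  by rewrite /t phiXn ?mulr0 //; lia.
rewrite -phiN -mulrN -sum_X_binp GpolyE mulr_suml phi_sum; apply: eq_bigr => k _.
rewrite !mulr_sumr phi_sum; apply: eq_bigr => l _; rewrite -!phiMC; congr phi.
rewrite !rmorphM /= (rmorph_sign (@polyC F)) !(rmorph_nat (@polyC F)) exprD; ring.
Qed.

End ModP.

(** * Sums of inverses modulo p *)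

Section InverseSquares.
Variable p : nat.
Hypotheses (pp : prime p) (p3 : (3 < p)%N).
Local Notation F := 'F_p.
Local Notation g := (binp p).
Let pF : p \in [pchar F] := pchar_Fp pp.
Let p0 : (0 < p)%N := prime_gt0 pp.
Let podd : odd p := odd_prime_gt3 pp p3.

Lemma sum_Fp (h : F -> F) : \sum_(a < p) h a%:R = \sum_y h y.
Proof.
have inj : injective (fun a : 'I_p => a%:R : F).
  move=> a b /eqP; wlog ab : a b / (a <= b)%N.
    move=> W; case: (leqP a b) => [/W//|/ltnW ba]; rewrite eq_sym => E.
    by apply/esym; exact: W ba E.
  rewrite eq_sym -subr_eq0 -natrB // -(dvdn_pcharf pF) => pba.
  apply/val_inj/eqP; rewrite eqn_leq ab /= -subn_eq0.
  case: posnP => // ba; move: pba; rewrite gtnNdvd //.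
  exact: leq_ltn_trans (leq_subr _ _) (ltn_ord b).
rewrite [RHS](reindex (fun a : 'I_p => a%:R : F)) //.
apply/onW_bij/inj_card_bij => //; by rewrite card_Fp ?card_ord.
Qed.

Lemma natr_Fp_neq0 n : (0 < n <= 3)%N -> n%:R != 0 :> F.
Proof. by move=> n3; apply: (natr_neq0_pchar pF); lia. Qed.

Lemma sum_invF : \sum_(y : F) y^-1 = 0.
Proof.
apply: (mulfI (natr_Fp_neq0 (isT : 0 < 2 <= 3)%N)); rewrite mulr0 mulr_natl mulr2n.
rewrite {1}(reindex_inj oppr_inj) /= -big_split big1 //= => y _.
by rewrite invrN addNr.
Qed.

Lemma sum_inv_sqF : \sum_(y : F) y^-1 ^+ 2 = 0.
Proof.
have n2 := natr_Fp_neq0 (isT : 0 < 2 <= 3)%N.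
have n3 := natr_Fp_neq0 (isT : 0 < 3 <= 3)%N.
(* Substituting 2y for y gives S = S/4, and 4 - 1 = 3 is invertible. *)
set S := LHS; have E : 4%:R * S = S.
  rewrite {1}/S (reindex_inj (mulfI n2)) /= mulr_sumr; apply: eq_bigr => y _.
  by rewrite invfM exprMn mulrA -[RHS]mul1r; congr (_ * _); field.
apply: (mulfI n3); rewrite mulr0.
by transitivity (4%:R * S - S); [ring | rewrite E subrr].
Qed.

(** For c nonzero, use partial fractions; at y = 0 and y = c the convention 0^-1 = 0 costs c^-2
    each, which is the whole value. *)
Lemma sum_inv_conv (c : F) : \sum_(y : F) y^-1 * (c - y)^-1 = - 2%:R * c^-1 ^+ 2.
Proof.
case: (eqVneq c 0) => [->|c0].
  transitivity (- \sum_(y : F) y^-1 ^+ 2); last first.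
    by rewrite sum_inv_sqF invr0 expr0n mulr0 oppr0.
  by rewrite -sumrN; apply: eq_bigr => y _; rewrite sub0r invrN mulrN expr2.
rewrite (eq_bigr (fun y : F => c^-1 * (y^-1 + (c - y)^-1) -
   (y == 0)%:R * c^-1 ^+ 2 - (y == c)%:R * c^-1 ^+ 2)); last first.
  move=> y _; case: (eqVneq y 0) => [->|y0].
    by rewrite [0 == c]eq_sym (negbTE c0) invr0 subr0 /=; ring.
  case: (eqVneq y c) => [->|yc]; first by rewrite subrr invr0 /=; ring.
  by rewrite /=; field; rewrite y0 c0 subr_eq0 eq_sym yc.
have delta (d : F) : \sum_(y : F) (y == d)%:R = 1 :> F.
  by rewrite (bigD1 d) //= eqxx big1 ?addr0 // => i /negbTE ->.
rewrite !sumrB -!mulr_suml !delta -mulr_sumr big_split /= sum_invF.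
rewrite (reindex_inj (subrI c)) /=.
under [X in _ * (0 + X)]eq_bigr do rewrite subKr.
rewrite sum_invF; ring.
Qed.

Lemma sum_inv_chi u : \sum_(b < p) (-1) ^+ b * (b%:R)^-1 * chi F (u + (b + b)) = 0.
Proof.
transitivity (- (\sum_(k < p) (g k)%:R * chi int (u + (k + k)))%:~R : F); last first.
  by rewrite sum_binp_chi // rmorph0 oppr0.
rewrite rmorph_sum -sumrN; apply: eq_bigr => b _ /=.
by rewrite rmorphM rmorph_chi rmorph_nat (binp_modp pp) // mulNr opprK.
Qed.

(** The substitution i = a + b modulo n. *)
Lemma sum_rot (V : nmodType) n a (f : nat -> V) : (a <= n)%N ->
  \sum_(b < n) f b = \sum_(i < n) if (a <= i)%N then f (i - a)%N else f (i + n - a)%N.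
Proof.
move=> an.
rewrite -(big_mkord xpredT f) (big_cat_nat (n := n - a)) ?leq_subr //=.
rewrite -(big_mkord xpredT (fun i => if (a <= i)%N then f (i - a)%N else f (i + n - a)%N)).
rewrite [RHS](big_cat_nat (n := a)) //= addrC; congr (_ + _).
  rewrite -{1}[(n - a)%N]add0n big_addn subKn //.
  apply: eq_big_nat => i /andP[_ ia]; rewrite leqNgt ia /=; congr f; lia.
rewrite [RHS](big_addn 0 n a).
by apply: eq_big_nat => i _; rewrite leq_addl addnK.
Qed.

(* By sum_inv_chi the sum of (-1)^(a+b) chi (2a+2b) / (ab) over all a, b < p is 0.
   Sort the pairs by n = a + b mod p: those with a + b < p and those with
   a + b >= p share the inner sums K n, up to the complete sum over a. *)
Lemma sum_conv_chi :
  phi p (Gpoly F p * Gpoly F p) =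
  2%:R * \sum_(n < p) (-1) ^+ n * chi F (n + n + (p + p)) * (n%:R)^-1 ^+ 2.
Proof.
pose q (a n : nat) : F := (a%:R)^-1 * (n%:R - a%:R)^-1.
pose K (n : nat) := \sum_(a < p | (a <= n)%N) q a n.
have T n : \sum_(a < p) q a n = - 2%:R * (n%:R)^-1 ^+ 2.
  by rewrite (sum_Fp (fun y => y^-1 * (n%:R - y)^-1)) sum_inv_conv.
have GK n : (n < p)%N -> (Gpoly F p * Gpoly F p)`_n = (-1) ^+ n * K n.
  move=> np; rewrite coefM /K.
  rewrite (big_ord_widen_cond p xpredT (fun a => (Gpoly F p)`_a * (Gpoly F p)`_(n - a))) //.
  rewrite mulr_sumr; apply: eq_big => [a|a /= an]; first by rewrite ltnS.
  rewrite !coef_poly ltn_ord (leq_ltn_trans (leq_subr _ _) np).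
  rewrite !(binp_modp pp) ?(leq_ltn_trans (leq_subr _ _) np) // /q natrB //.
  have -> : (-1) ^+ n = (-1) ^+ a * (-1) ^+ (n - a) :> F by rewrite -exprD subnKC.
  ring.
rewrite phiE //; under eq_bigr do rewrite GK //.
pose Z := \sum_(n < p) (-1) ^+ n * (K n * (chi F (n + n) + chi F (n + n + (p + p)))
    + chi F (n + n + (p + p)) * (2%:R * (n%:R)^-1 ^+ 2)).
have Z0 : Z = 0.
  transitivity (\sum_(a < p) \sum_(b < p)
    (-1) ^+ (a + b) * (a%:R)^-1 * (b%:R)^-1 * chi F ((a + b) + (a + b))); last first.
    rewrite big1 // => a _.
    transitivity ((-1) ^+ a * (a%:R)^-1 *
      \sum_(b < p) (-1) ^+ b * (b%:R)^-1 * chi F (a + a + (b + b))); last first.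
      by rewrite sum_inv_chi mulr0.
    rewrite mulr_sumr; apply: eq_bigr => b _; rewrite exprD addnACA; ring.
  transitivity (\sum_(a < p) \sum_(n < p)
    (-1) ^+ n * q a n * (if (a <= n)%N then chi F (n + n) else - chi F (n + n + (p + p)))).
    rewrite exchange_big; apply: eq_bigr => n _ /=.
    transitivity ((-1) ^+ n * chi F (n + n) * K n +
        - ((-1) ^+ n * chi F (n + n + (p + p))) * \sum_(a < p | ~~ (a <= n)%N) q a n).
      have -> : \sum_(a < p | ~~ (a <= n)%N) q a n = - 2%:R * (n%:R)^-1 ^+ 2 - K n.
        by rewrite -T [X in _ = X - _](bigID (fun a : 'I_p => (a <= n)%N)) /= -/(K n) addrAC subrr add0r.
      ring.
    rewrite [RHS](bigID (fun a : 'I_p => (a <= n)%N)) /= !mulr_sumr.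
    by congr (_ + _); apply: eq_bigr => a; [move=> -> | move/negbTE=> ->]; ring.
  apply: eq_bigr => a _.
  rewrite (sum_rot (fun b => (-1) ^+ (a + b) * (a%:R)^-1 * (b%:R)^-1 * chi F ((a + b) + (a + b)))
    (ltnW (ltn_ord a))) /=; apply: eq_bigr => n _.
  have ap := ltn_ord a.
  case: leqP => an; first by rewrite subnKC // natrB // /q; ring.
  have -> : (a + (n + p - a) = n + p)%N by lia.
  rewrite natrB; last by lia.
  rewrite natrD (pcharf0 pF) addr0 addnACA exprD -[(-1) ^+ p]signr_odd podd /q; ring.
apply: subr0_eq; transitivity (- Z); last by rewrite Z0 oppr0.
rewrite mulr_sumr -sumrB -sumrN; apply: eq_bigr => n _.
(* Modulo 3, p - n is 2n + p, and 2n, 2n + p, 2n + 2p represent all classes. *)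
have -> : chi F (p - n) = - (chi F (n + n) + chi F (n + n + (p + p))).
  have := prime_gt3_mod3 pp p3; have := ltn_ord n; rewrite /chi => ? ?.
  by repeat (case: eqP => ?); try (exfalso; lia); ring.
ring.
Qed.
End InverseSquares.

(** * Inverse squares modulo p over intervals and progressions *)

Section InvSq.
Variable p : nat.
Hypotheses (pp : prime p) (p3 : (3 < p)%N).
Local Notation F := 'F_p.
Let pF : p \in [pchar F] := pchar_Fp pp.
Let p0 : (0 < p)%N := prime_gt0 pp.
Let podd : odd p := odd_prime_gt3 pp p3.

(* The summand at r = 0 is 0, as 0^-1 = 0. *)
Definition invsq (P : pred nat) : F := \sum_(r < p | P r) (r%:R)^-1 ^+ 2.

Lemma eq_invsq (P Q : pred nat) :
  (forall r, (0 < r < p)%N -> P r = Q r) -> invsq P = invsq Q.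
Proof.
move=> PQ; rewrite /invsq big_mkcond [RHS]big_mkcond; apply: eq_bigr => r _ /=.
case: (posnP r) => [->|r0]; first by rewrite invr0 expr0n /= !if_same.
by rewrite PQ // r0 ltn_ord.
Qed.

Lemma invsqID (A P : pred nat) :
  invsq P = invsq (fun r => P r && A r) + invsq (fun r => P r && ~~ A r).
Proof. by rewrite /invsq (bigID (fun r : 'I_p => A r)). Qed.

Lemma invsqT : invsq xpredT = 0.
Proof. by rewrite /invsq (sum_Fp pp (fun y => y^-1 ^+ 2)) sum_inv_sqF. Qed.

Lemma sum_reflect (V : nmodType) n (f : nat -> V) : f 0%N = 0 -> f n = 0 ->
  \sum_(r < n) f r = \sum_(r < n) f (n - r)%N.
Proof.
move=> f0 fn; transitivity (\sum_(r < n.+1) f r); first by rewrite big_ord_recr /= fn addr0.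
rewrite (reindex_inj rev_ord_inj) /= big_ord_recr /= !subSS subnn f0 addr0.
by apply: eq_bigr => r _; rewrite subSS.
Qed.

Lemma invsq_reflect (P : pred nat) : invsq P = invsq (fun r => P (p - r)%N).
Proof.
rewrite /invsq big_mkcond [RHS]big_mkcond /=.
rewrite (sum_reflect (f := fun r => if P r then (r%:R)^-1 ^+ 2 else 0 : F)).
- apply: eq_bigr => r _; case: (P _) => //.
  by rewrite natrB ?(ltnW (ltn_ord r)) // (pcharf0 pF) sub0r invrN sqrrN.
- by rewrite invr0 expr0n if_same.
- by rewrite (pcharf0 pF) invr0 expr0n if_same.
Qed.

Lemma invsq_dilate d (P : pred nat) : (0 < d)%N ->
  invsq (fun r => (d %| r)%N && P r) =
  (d%:R)^-1 ^+ 2 * invsq (fun i => (d * i < p)%N && P (d * i)%N).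
Proof.
move=> d0; rewrite /invsq mulr_sumr.
pose o0 := Ordinal p0.
(* An i with d i >= p is sent to the default 0, which goes back to 0 and not to i, so it is
   discarded. *)
rewrite (reindex_onto (fun i : 'I_p => insubd o0 (d * i)%N) (fun r => insubd o0 (r %/ d)%N)) /=.
  rewrite big_mkcond [RHS]big_mkcond; apply: eq_bigr => i _ /=.
  have ip := ltn_ord i.
  case: (ltnP (d * i) p) => dip /=; last first.
    case: ifP => // /andP[_ /eqP/(congr1 val)].
    rewrite !val_insubd (ltnNge (d * i)) dip /= div0n p0 => i0.
    by move: dip; rewrite -i0 muln0; lia.
  rewrite !val_insubd dip dvdn_mulr //= mulKn //.
  have -> : insubd o0 i = i by apply/val_inj; rewrite val_insubd ip.
  by rewrite eqxx andbT natrM invfM exprMn.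
move=> r /andP[dr _]; apply/val_inj; rewrite !val_insubd.
by rewrite (leq_ltn_trans (leq_div _ _)) // mulnC divnK // ltn_ord.
Qed.

(** Reflection exchanges the two halves of the complete sum, which is 0. *)
Lemma invsq_half : invsq (fun i => 2 * i < p)%N = 0.
Proof.
apply: (mulfI (natr_Fp_neq0 pp p3 (isT : 0 < 2 <= 3)%N)); rewrite mulr0 mulr_natl mulr2n.
rewrite {1}invsq_reflect -[RHS]invsqT (invsqID (fun i => 2 * i < p)%N xpredT) addrC.
by congr (_ + _); apply: eq_invsq => r /=; lia.
Qed.

(** For odd j < p/3, p - j = 2i with p/3 < i < p/2. Halving yields the factor 4, and by [invsq_half]
    the sum over these i is minus the one over i < p/3. *)
Lemma invsq_odd_third :
  4%:R * invsq (fun j => (3 * j < p)%N && odd j) = - invsq (fun j => 3 * j < p)%N.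
Proof.
have n2 := natr_Fp_neq0 pp p3 (isT : 0 < 2 <= 3)%N.
rewrite invsq_reflect.
rewrite (@eq_invsq _ (fun r => (2 %| r) && (2 * p < 3 * r))%N); last first.
  by move=> r /andP[r0 rp] /=; rewrite oddB ?(ltnW rp) // podd dvdn2 /=; lia.
rewrite invsq_dilate // (@eq_invsq _ (fun i => (2 * i < p) && ~~ (3 * i < p))%N); last first.
  have := prime_gt3_mod3 pp p3; move=> p_mod3 r rp /=; lia.
have := invsq_half; rewrite (invsqID (fun i => 3 * i < p)%N).
rewrite (@eq_invsq (fun i => (2 * i < p) && (3 * i < p))%N (fun i => 3 * i < p)%N); last first.
  move=> r rp /=; lia.
move/eqP; rewrite addr_eq0 => /eqP ->; rewrite opprK.
by field.
Qed.

(** In [sum_conv_chi] the character is chi(p) ([3 | p - n] - [3 | n]), so reflection leaves an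
    alternating sum over multiples of 3. Dividing these by 3 gives 1/9 of the even minus the odd
    part over j < p/3, evaluated by [invsq_odd_third]. *)
Lemma phi_G_sq_modp :
  3%:R * phi p (Gpoly F p * Gpoly F p) = - 2%:R * chi F p * invsq (fun j => 3 * j < p)%N.
Proof.
have n2 := natr_Fp_neq0 pp p3 (isT : 0 < 2 <= 3)%N.
have n3 := natr_Fp_neq0 pp p3 (isT : 0 < 3 <= 3)%N.
rewrite sum_conv_chi //.
pose f (r : nat) : F := if (3 %| r)%N then (-1) ^+ r * (r%:R)^-1 ^+ 2 else 0.
have -> : \sum_(n < p) (-1) ^+ n * chi F (n + n + (p + p)) * (n%:R)^-1 ^+ 2 =
   chi F p * (- 2%:R * \sum_(r < p) f r).
  have -> : - 2%:R * \sum_(r < p) f r = - (\sum_(r < p) f (p - r)%N) - \sum_(r < p) f r.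
    rewrite -sum_reflect; first by ring.
    - by rewrite /f invr0 expr0n /= mulr0 ?if_same.
    - by rewrite /f (pcharf0 pF) invr0 expr0n /= mulr0 if_same.
  rewrite -!sumrN -big_split mulr_sumr; apply: eq_bigr => r _ /=.
  have rp := ltn_ord r.
  have -> : f (p - r)%N = if (3 %| p - r)%N then - ((-1) ^+ r * (r%:R)^-1 ^+ 2) else 0.
    rewrite /f natrB ?(ltnW rp) // (pcharf0 pF) sub0r invrN sqrrN.
    rewrite -signr_odd oddB ?(ltnW rp) // podd addTb signrN signr_odd.
    by case: ifP => // _; rewrite mulNr.
  have -> : chi F (r + r + (p + p)) = chi F p * ((3 %| p - r)%N%:R - (3 %| r)%N%:R).
    have -> : (3 %| p - r)%N = ((p %% 3 + 2 * (r %% 3)) %% 3 == 0)%N.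
      by rewrite /dvdn; congr (_ == _); lia.
    rewrite (@chi_mod _ _ (2 * (r %% 3) + 2 * (p %% 3))%N); last by lia.
    rewrite (@chi_mod _ p (p %% 3)%N) ?modn_mod // /dvdn.
    have := ltn_pmod r (isT : 0 < 3)%N; have := ltn_pmod p (isT : 0 < 3)%N.
    have := prime_gt3_mod3 pp p3.
    by move: (r %% 3)%N (p %% 3)%N => [|[|[|[]]]] // [|[|[|[]]]] //= _ _ _; rewrite /chi /=; ring.
  by rewrite /f; case: (3 %| _)%N; case: (3 %| _)%N => /=; ring.
have -> : \sum_(r < p) f r = invsq (fun r => (3 %| r) && ~~ odd r)%N - invsq (fun r => (3 %| r) && odd r)%N.
  rewrite /invsq [X in _ = X - _]big_mkcond [X in _ = _ - X]big_mkcond -sumrB; apply: eq_bigr => r _ /=.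
  by rewrite /f -signr_odd; case: (3 %| r)%N; case: (odd r) => /=; ring.
rewrite !invsq_dilate //.
rewrite (@eq_invsq (fun i => _ && odd (3 * i))%N (fun i => (3 * i < p) && odd i)%N); last first.
  by move=> r _; rewrite oddM.
rewrite (@eq_invsq (fun i => _ && ~~ odd (3 * i))%N (fun i => (3 * i < p) && ~~ odd i)%N); last first.
  by move=> r _; rewrite oddM.
have := invsq_odd_third; rewrite (invsqID odd (fun i => 3 * i < p)%N).
move: (invsq _) (invsq _) (chi F p) => a b c E.
have -> : a = - (4%:R * b) - b by rewrite E; ring.
by field.
Qed.

End InvSq.

(** * Bernoulli polynomials *)

Lemma size_bern_seq n : size (bern_seq n) = n.+1.
Proof. by elim: n => //= n IHn; rewrite size_rcons IHn. Qed.

Lemma nth_bern_seq n k : (k <= n)%N -> (bern_seq n)`_k = bernoulli k.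
Proof.
elim: n => [|n IHn]; first by rewrite leqn0 => /eqP ->.
rewrite leq_eqVlt => /orP[/eqP -> //|kn].
by rewrite /= nth_rcons size_bern_seq kn IHn.
Qed.

Lemma bernoulliS n : bernoulli n.+1 =
  - (n.+2%:R)^-1 * \sum_(k < n.+1) 'C(n.+2, k)%:R * bernoulli k.
Proof.
rewrite /bernoulli /= nth_rcons size_bern_seq ltnn eqxx; congr (_ * _).
by apply: eq_bigr => k _; rewrite nth_bern_seq // -ltnS.
Qed.

Lemma sum_bin_bernoulli n :
  \sum_(k < n.+1) 'C(n.+1, k)%:R * bernoulli k = (n == 0%N)%:R.
Proof.
case: n => [|n]; first by rewrite big_ord1 bin0 mul1r.
rewrite big_ord_recr /= bernoulliS binSn mulrA mulrN divff ?pnatr_eq0 //.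
by rewrite mulN1r subrr.
Qed.

(* The umbral functional sending X^n to B_n. *)
Definition umbral (f : {poly rat}) : rat :=
  \sum_(k < size f) f`_k * bernoulli k.

Lemma umbralE n (f : {poly rat}) : (size f <= n)%N ->
  umbral f = \sum_(k < n) f`_k * bernoulli k.
Proof.
move=> fn; rewrite /umbral (big_ord_widen n (fun k => f`_k * bernoulli k)) //.
rewrite big_mkcond; apply: eq_bigr => k _; case: ltnP => // fk.
by rewrite nth_default ?mul0r.
Qed.

Lemma umbralD f g : umbral (f + g) = umbral f + umbral g.
Proof.
pose n := maxn (size f) (size g).
rewrite (@umbralE n (f + g)) ?size_polyD // (@umbralE n f) ?leq_maxl // (@umbralE n g) ?leq_maxr //.
by rewrite -big_split; apply: eq_bigr => k _; rewrite coefD mulrDl.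
Qed.

Lemma umbralZ c f : umbral (c *: f) = c * umbral f.
Proof.
rewrite (umbralE (size_scale_leq c f)) /umbral mulr_sumr.
by apply: eq_bigr => k _; rewrite coefZ mulrA.
Qed.

Lemma umbralB f g : umbral (f - g) = umbral f - umbral g.
Proof. by rewrite umbralD -scaleN1r umbralZ mulN1r. Qed.

Lemma umbral_sum (I : Type) (r : seq I) (P : pred I) (F : I -> {poly rat}) :
  umbral (\sum_(i <- r | P i) F i) = \sum_(i <- r | P i) umbral (F i).
Proof.
apply: (big_morph _ umbralD); by rewrite /umbral size_poly0 big_ord0.
Qed.

Lemma umbralXn n : umbral 'X^n = bernoulli n.
Proof.
rewrite /umbral size_polyXn big_ord_recr /= coefXn eqxx mul1r big1 ?add0r // => k _.
by rewrite coefXn ltn_eqF // mul0r.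
Qed.

Lemma size_addCXn (c : rat) n : size ((c%:P + 'X) ^+ n) = n.+1.
Proof. by rewrite addrC -[c]opprK polyCN size_exp_XsubC. Qed.

Lemma umbral_bernoulli_poly n (c : rat) :
  umbral ((c%:P + 'X) ^+ n) = bernoulli_poly n c.
Proof.
rewrite /umbral size_addCXn; apply: eq_bigr => k _.
by rewrite coef_addCXn mulrAC.
Qed.

Lemma umbral_X1n n : umbral ((1 + 'X) ^+ n) = bernoulli n + (n == 1%N)%:R.
Proof.
rewrite -polyC1 umbral_bernoulli_poly /bernoulli_poly.
under eq_bigr do rewrite expr1n mulr1.
rewrite big_ord_recr /= binn mul1r addrC; congr (_ + _).
by case: n => [|n]; [rewrite big_ord0 | rewrite sum_bin_bernoulli].
Qed.

(** Umbrally f(B + 1) = f(B) + f'(0), by linearity from the powers of X. *)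
Lemma umbral_diff (f : {poly rat}) : umbral (f \Po (1 + 'X)) = umbral f + f`_1.
Proof.
rewrite comp_polyE umbral_sum.
under eq_bigr do rewrite umbralZ umbral_X1n mulrDr.
rewrite big_split /=; congr (_ + _).
case: (ltnP 1 (size f)) => f1.
  rewrite (bigD1 (Ordinal f1)) //= mulr1 big1 ?addr0 // => i.
  by rewrite -val_eqE /= => /negbTE ->; rewrite mulr0.
rewrite nth_default // big1 // => i _.
by rewrite ltn_eqF ?mulr0 // (leq_trans (ltn_ord i)).
Qed.

Lemma bernoulli_polyS n (c : rat) :
  bernoulli_poly n (c + 1) = bernoulli_poly n c + n%:R * c ^+ n.-1.
Proof.
rewrite -!umbral_bernoulli_poly.
have -> : ((c + 1)%:P + 'X) ^+ n = (c%:P + 'X) ^+ n \Po (1 + 'X).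
  by rewrite rmorphXn /= comp_polyD comp_polyC comp_polyX polyCD polyC1 addrA.
by rewrite umbral_diff coef_addCXn bin1 subn1.
Qed.

Lemma bernoulli_poly_nat n m : bernoulli_poly n m%:R =
  bernoulli n + n%:R * \sum_(j < m) (j%:R) ^+ n.-1.
Proof.
elim: m => [|m IHm].
  rewrite big_ord0 mulr0 addr0 -umbral_bernoulli_poly polyC0 add0r.
  by rewrite umbralXn.
by rewrite -[m.+1]addn1 natrD bernoulli_polyS IHm addn1 big_ord_recr mulrDr addrA.
Qed.

(* Both sides satisfy the recurrence defining the Bernoulli numbers. *)
Lemma umbral_reflect n : umbral ((- 1 - 'X) ^+ n) = bernoulli n.
Proof.
elim/ltn_ind: n => n IHn.
have E : \sum_(k < n.+1) 'C(n.+1, k)%:R * umbral ((- 1 - 'X) ^+ k) = (n == 0%N)%:R.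
  have -> : \sum_(k < n.+1) 'C(n.+1, k)%:R * umbral ((- 1 - 'X) ^+ k) =
      umbral ((- 'X) ^+ n.+1) - umbral ((- 1 - 'X) ^+ n.+1).
    rewrite -umbralB.
    have -> : (- 'X) ^+ n.+1 = (1 + (- 1 - 'X)) ^+ n.+1 :> {poly rat} by congr (_ ^+ _); ring.
    rewrite [in RHS]exprDn [in RHS]big_ord_recr /= binn subnn mul1r mulr1n addrK umbral_sum.
    by apply: eq_bigr => k _; rewrite expr1n mul1r -umbralZ -scaler_nat.
  (* By [umbral_diff] the difference is minus the linear coefficient of (-X)^(n+1). *)
  have -> : (- 1 - 'X) ^+ n.+1 = (- 'X) ^+ n.+1 \Po (1 + 'X) :> {poly rat}.
    by rewrite rmorphXn /= rmorphN /= comp_polyX; congr (_ ^+ _); ring.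
  rewrite umbral_diff opprD addrA subrr add0r.
  case: {IHn} n => [|n]; first by rewrite expr1 coefN coefX opprK.
  by rewrite exprNn -signr_odd mulr_sign; case: ifP => _; rewrite ?coefN coefXn ?oppr0.
move: E; rewrite -(sum_bin_bernoulli n) big_ord_recr [RHS]big_ord_recr /=.
rewrite (eq_bigr (fun k : 'I_n => 'C(n.+1, k)%:R * bernoulli k)); last first.
  by move=> k _; rewrite IHn.
move/addrI; apply: mulfI; by rewrite binSn pnatr_eq0.
Qed.

(** For odd n, (-1 - X)^n = -(1 + X)^n, so [umbral_reflect] yields B_n = -B_n. *)
Lemma bernoulli_odd n : odd n -> (1 < n)%N -> bernoulli n = 0.
Proof.
move=> nodd n1; have := umbral_reflect n.
have -> : (- 1 - 'X) ^+ n = - 1 *: (1 + 'X) ^+ n :> {poly rat}.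
  by rewrite -opprD exprNn -signr_odd nodd expr1 mulN1r scaleN1r.
rewrite umbralZ umbral_X1n (gtn_eqF n1) addr0 mulN1r => /eqP.
by rewrite eq_sym -addr_eq0 -mulr2n mulrn_eq0 /= => /eqP.
Qed.

(** * Reduction of p-integral rationals modulo p *)

Section Reduction.
Variable p : nat.
Hypothesis pp : prime p.
Local Notation F := 'F_p.
Let pF : p \in [pchar F] := pchar_Fp pp.

(* q is p-integral and z is its residue class modulo p. *)
Definition reduces (q : rat) (z : F) : Prop :=
  exists a b : int, [/\ b%:~R != 0 :> F, q * b%:~R = a%:~R & z * b%:~R = a%:~R].

Lemma reduces_int (a : int) : reduces a%:~R a%:~R.
Proof. by exists a, 1; rewrite !mulr1 oner_neq0. Qed.

Lemma reduces_nat (n : nat) : reduces n%:R n%:R.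
Proof. exact: (reduces_int n). Qed.

Lemma reducesD q r y z : reduces q y -> reduces r z -> reduces (q + r) (y + z).
Proof.
move=> [a [b [b0 qb yb]]] [c [d [d0 rd zd]]].
exists (a * d + c * b), (b * d); rewrite !(rmorphM, rmorphD) /= mulf_neq0 //.
by rewrite -qb -rd -yb -zd; split => //; ring.
Qed.

Lemma reducesM q r y z : reduces q y -> reduces r z -> reduces (q * r) (y * z).
Proof.
move=> [a [b [b0 qb yb]]] [c [d [d0 rd zd]]].
exists (a * c), (b * d); rewrite !rmorphM /= mulf_neq0 //.
by rewrite -qb -rd -yb -zd; split => //; ring.
Qed.

Lemma reducesN q y : reduces q y -> reduces (- q) (- y).
Proof.
move=> H; rewrite -mulN1r -[- y]mulN1r; apply: reducesM H.
exact: (reduces_int (-1)).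
Qed.

Lemma reduces_natV (n : nat) : n%:R != 0 :> F -> reduces (n%:R)^-1 (n%:R)^-1.
Proof.
move=> n0; have nq : n%:R != 0 :> rat.
  by rewrite pnatr_eq0; apply: contraNneq n0 => ->.
by exists 1, n; split; rewrite // mulVf.
Qed.

Lemma reducesX q y n : reduces q y -> reduces (q ^+ n) (y ^+ n).
Proof.
move=> H; elim: n => [|n IHn]; first exact: (reduces_nat 1).
by rewrite !exprS; apply: reducesM.
Qed.

Lemma reduces_sum (I : Type) (r : seq I) (P : pred I) (f : I -> rat) (h : I -> F) :
  (forall i, P i -> reduces (f i) (h i)) ->
  reduces (\sum_(i <- r | P i) f i) (\sum_(i <- r | P i) h i).
Proof.
move=> fh; apply: (big_ind2 reduces) => //; first exact: (reduces_nat 0).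
by move=> *; apply: reducesD.
Qed.

Lemma reduces_inj q y z : reduces q y -> reduces q z -> y = z.
Proof.
move=> [a [b [b0 qb yb]]] [c [d [d0 qd zd]]].
have E : a * d = c * b.
  apply: (@intr_inj rat); rewrite !rmorphM /= -qb -qd; ring.
have := congr1 (intr : int -> F) E; rewrite !rmorphM /= -yb -zd => E'.
by apply: (mulIf (mulf_neq0 b0 d0)); rewrite mulrA E'; ring.
Qed.

(** If q = a/b with p dividing a but not b, the reduced denominator of (a/p)/b divides b. *)
Lemma reduces0_denq (q : rat) : reduces q 0 -> coprime p `|denq (q / p%:R)|%N.
Proof.
move=> [a [b [b0 qb]]]; rewrite mul0r => /esym/eqP.
rewrite -(dvdz_pcharf pF) => /dvdzP[c ac].
have pn0 : p%:R != 0 :> rat by rewrite pnatr_eq0 -lt0n prime_gt0.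
set r := q / p%:R.
have rb : r * b%:~R = c%:~R.
  apply: (mulIf pn0); rewrite /r mulrAC mulfVK // qb ac rmorphM //.
have E : numq r * b = c * denq r.
  apply: (@intr_inj rat); rewrite !rmorphM /= numqE -rb; ring.
have db : (`|denq r| %| `|b|)%N.
  rewrite -(Gauss_dvdr _ (m := `|denq r|%N) (n := `|numq r|%N)).
    by rewrite -abszM E abszM dvdn_mull.
  by rewrite coprime_sym coprime_num_den.
rewrite prime_coprime //; apply: contra b0 => pd.
by rewrite -(dvdz_pcharf pF) dvdzE /= (dvdn_trans pd db).
Qed.

(** The recurrence for B_n divides only by n + 1 < p. *)
Lemma bernoulli_reduces n : (n.+1 < p)%N -> exists z, reduces (bernoulli n) z.
Proof.
elim/ltn_ind: n => -[|n] IHn np; first by exists 1; exact: (reduces_nat 1).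
rewrite bernoulliS.
have [y yP] : exists y, reduces (\sum_(k < n.+1) 'C(n.+2, k)%:R * bernoulli k) y.
  apply: (big_ind (fun q => exists y, reduces q y)).
  - by exists 0; exact: (reduces_nat 0).
  - by move=> q r [y yq] [z zr]; exists (y + z); apply: reducesD.
  move=> k _; have kn := ltn_ord k.
  have [z zP] : exists z, reduces (bernoulli k) z by apply: IHn; lia.
  by exists ('C(n.+2, k)%:R * z); apply: reducesM zP; apply: reduces_nat.
exists (- (n.+2%:R)^-1 * y); apply: reducesM yP; apply/reducesN/reduces_natV.
by rewrite (natr_neq0_pchar pF).
Qed.

(** This allows 1/3 to be replaced by an integer congruent to it. *)
Lemma bernoulli_poly_reduces n (c d : rat) (z : F) : (n.+1 < p)%N ->
  reduces c z -> reduces d z ->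
  exists y, reduces (bernoulli_poly n c) y /\ reduces (bernoulli_poly n d) y.
Proof.
move=> np cz dz; rewrite /bernoulli_poly.
apply: (big_rec2 (fun q r => exists y, reduces q y /\ reduces r y)).
  by exists 0; split; exact: (reduces_nat 0).
move=> k q r _ [y [qy ry]]; have kn := ltn_ord k.
have [|b bP] := @bernoulli_reduces k; first by lia.
exists ('C(n, k)%:R * b * z ^+ (n - k) + y).
by split; apply: reducesD => //; do 2?[apply: reducesM => //]; by [apply: reduces_nat | apply: reducesX].
Qed.

Hypothesis p3 : (3 < p)%N.

(** Fermat's little theorem; at j = 0 both summands are 0 because p > 3. *)
Lemma sum_pow_inv_sq m : (m <= p)%N ->
  \sum_(j < m) (j%:R ^+ (p - 3)) = invsq p (fun j => j < m)%N :> F.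
Proof.
move=> mp; rewrite /invsq -(big_ord_widen p (fun j => (j%:R)^-1 ^+ 2 : F) mp).
apply: eq_bigr => j _; case: (eqVneq (j%:R : F) 0) => [->|j0].
  by rewrite invr0 !expr0n subn_eq0 leqNgt p3.
apply: (mulIf (expf_neq0 3 j0)); rewrite -exprD subnK ?(ltnW p3) //.
have -> : j%:R ^+ p = j%:R :> F by have := expf_card (j%:R : F); rewrite card_Fp.
by rewrite exprVn [_ ^+ 3]exprSr mulKf // expf_neq0.
Qed.

Lemma bernoulli_third : reduces (bernoulli_poly (p - 2) (1 / 3%:R))
  (2%:R * chi F p * invsq p (fun j => 3 * j < p)%N).
Proof.
have n3 := natr_Fp_neq0 pp p3 (isT : 0 < 3 <= 3)%N.
have podd := odd_prime_gt3 pp p3.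
(* The divisions are exact, and 3m is p + 1 or 2p + 1, so m represents 1/3. *)
pose m := if (p %% 3 == 2)%N then ((p + 1) %/ 3)%N else ((2 * p + 1) %/ 3)%N.
have p_mod3 := prime_gt3_mod3 pp p3.
have mp : (m <= p)%N by rewrite /m; case: ifP => _; lia.
have m3 : m%:R = (3%:R)^-1 :> F.
  apply: (mulIf n3); rewrite mulVf // -natrM.
  have -> : (m * 3 = (if (p %% 3 == 2)%N then 1 else 2) * p + 1)%N.
    by rewrite /m; case: eqP => ?; lia.
  by rewrite natrD natrM (pcharf0 pF) mulr0 add0r.
have third : reduces (1 / 3%:R) m%:R by rewrite m3 div1r; apply: reduces_natV.
have [|y [y1 y2]] := bernoulli_poly_reduces (n := p - 2) _ third (reduces_nat m); first by lia.
suff -> : 2%:R * chi F p * invsq p (fun j => 3 * j < p)%N = y by [].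
have : reduces (bernoulli_poly (p - 2) m%:R) ((p - 2)%:R * \sum_(j < m) (j%:R ^+ (p - 3))).
  rewrite bernoulli_poly_nat bernoulli_odd; [|by rewrite oddB ?podd //; lia|by lia].
  rewrite add0r; apply: reducesM; first exact: reduces_nat.
  have -> : (p - 2).-1 = (p - 3)%N by lia.
  by apply: reduces_sum => j _; apply: reducesX; apply: reduces_nat.
rewrite sum_pow_inv_sq // => y3; rewrite (reduces_inj y2 y3).
rewrite natrB; last by lia.
rewrite (pcharf0 pF) sub0r /chi /m.
have : (p %% 3 == 1)%N || (p %% 3 == 2)%N by lia.
case: eqP => [p1 _|_ /= p2].
  have -> : invsq p (fun j => j < if (p %% 3 == 2)%N then (p + 1) %/ 3 else (2 * p + 1) %/ 3)%N =
      - invsq p (fun j => 3 * j < p)%N; last by ring.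
    (* Reflection turns j < p/3 into r > 2p/3, the complement of r < m in the complete sum 0. *)
    apply/eqP; rewrite -addr_eq0 [X in _ + X]invsq_reflect // -(invsqT pp p3).
    rewrite (invsqID p (fun j => j < (2 * p + 1) %/ 3)%N xpredT) p1 /=.
    by apply/eqP; congr (_ + _); apply: eq_invsq => r rp /=; lia.
rewrite p2; have -> : invsq p (fun j => j < (p + 1) %/ 3)%N = invsq p (fun j => 3 * j < p)%N.
  by apply: eq_invsq => r rp /=; lia.
ring.
Qed.

End Reduction.

(** * The congruence modulo p^3 *)

Theorem theorem1p2 (p : nat) :
  prime p -> (3 < p)%N ->
  rat_congr p 3
    (\sum_(k < p) (-1) ^+ k * (franel k)%:R)
    (legendre3 p + 2%:R * (p ^ 2)%:R / 3%:R * bernoulli_poly (p - 2) (1 / 3%:R)).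
Proof.
move=> pp p3; have n3 := natr_Fp_neq0 pp p3 (isT : 0 < 3 <= 3)%N.
pose t : int := tau p - phi p (Gpoly int p * Gpoly int p).
have pn0 : p%:R != 0 :> rat by rewrite pnatr_eq0 -lt0n prime_gt0.
have E : \sum_(k < p) (-1) ^+ k * (franel k)%:R = chi rat p + p%:R ^+ 2 * t%:~R :> rat.
  have := congr1 (intr : int -> rat) (alt_sum_franel pp p3).
  rewrite rmorphD rmorphM rmorphXn rmorph_chi rmorph_nat /= => <-.
  rewrite rmorph_sum; apply: eq_bigr => k _.
  by rewrite rmorphM rmorph_sign rmorph_nat.
set B := bernoulli_poly _ _.
have -> : legendre3 p = chi rat p by [].
rewrite /rat_congr {}E natrX.
have -> : (chi rat p + p%:R ^+ 2 * t%:~R - (chi rat p + 2%:R * p%:R ^+ 2 / 3%:R * B)) / (p ^ 3)%:R =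
    (t%:~R - 2%:R / 3%:R * B) / p%:R.
  by rewrite natrX; field.
apply: (reduces0_denq pp).
have red3 := reduces_natV n3.
have : reduces (t%:~R - 2%:R / 3%:R * B)
    (t%:~R - 2%:R / 3%:R * (2%:R * chi 'F_p p * invsq p (fun j => 3 * j < p)%N)).
  apply: reducesD; first exact: reduces_int.
  apply/reducesN/reducesM; last exact: bernoulli_third.
  by apply: reducesM red3; apply: reduces_nat.
congr reduces.
(* Modulo p, t is -2 phi(G^2), which is 4/3 chi(p) Q by [phi_G_sq_modp], where Q is the sum of 1/j^2
   over j < p/3. *)
apply: (mulfI n3); rewrite mulr0 /t rmorphB /= tau_modp // -phi_map ?prime_gt0 //.
rewrite rmorphM /= map_Gpoly.
have /eqP := phi_G_sq_modp pp p3; rewrite -subr_eq0 => /eqP E.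
move: (phi _ _) (chi _ _) (invsq _ _) E => a c q E.
transitivity (- 2%:R * (3%:R * a - - 2%:R * c * q)); last by rewrite E mulr0.
by field.
Qed.
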